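(* Let $G=(V,E,\sigma,o)$ be a radially symmetric tree and suppose $\sigma$ is a radially symmetric weight that is bounded and uniformly elliptic. Then $$\lim_{p\to\infty}\mathrm{Mod}_{p,\sigma}(\Gamma_\infty)^{1/p}=0=\mathrm{Mod}_{\infty,\sigma}(\Gamma_\infty).$$
   Context: A weighted rooted tree $G=(V,E,\sigma,o)$ has root $o$ and weights $\sigma:E\to\mathbb{R}_{>0}$. The generation of an edge is the number of edges on the unique path from $o$ ending with it; $e$ is the parent of $e'$ if they are adjacent and $e'$ has generation one more. A proper infinite tree is infinite, locally finite, and every edge has at least one child; it is radially symmetric if the number of children of an edge depends only on its generation. $\sigma$ is radially symmetric if $\sigma(e)$ depends only on the generation of $e$, and bounded and uniformly elliptic if there are constants $0<\alpha_1\le\alpha_2$ with $\alpha_1\le\sigma(e)\le\alpha_2$ for all $e$. A descending path is a path $e_1e_2\cdots$ from $o$ with $e_i$ the parent of $e_{i+1}$; $\Gamma_\infty$ is the set of infinite descending paths. For $\rho:E\to[0,\infty)$, $\ell_\rho(\gamma)=\sum_{e\in\gamma}\rho(e)$; $\mathrm{Adm}(\Gamma_\infty)$ consists of $\rho\ge0$ with $\ell_\rho(\gamma)\ge1$ for all $\gamma\in\Gamma_\infty$. $\mathcal{E}_{p,\sigma}(\rho)=\sum_e\sigma(e)\rho(e)^p$ for $1\le p<\infty$, $\mathcal{E}_{\infty,\sigma}(\rho)=\sup_e\sigma(e)\rho(e)$, and $\mathrm{Mod}_{p,\sigma}(\Gamma_\infty)=\inf_{\rho\in\mathrm{Adm}(\Gamma_\infty)}\mathcal{E}_{p,\sigma}(\rho)$.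 *)

(* Defs.v *)
From mathcomp Require Import all_boot all_order all_algebra.
From mathcomp Require Import all_classical all_reals all_analysis.

Set Implicit Arguments.
Unset Strict Implicit.
Unset Printing Implicit Defensive.

Import Order.TTheory GRing.Theory Num.Theory.
Import numFieldNormedType.Exports.

Local Open Scope classical_set_scope.
Local Open Scope ring_scope.

Definition adjacent (V : choiceType) (E : set (set V)) : rel V :=
  fun x y => `[< E [set x; y] >].

(* Edges are the two-element sets of vertices belonging to [edge]; functions on
   edges are functions on [set vertex], whose values outside [edge] are
   irrelevant. The bound 2 in [tree_acyclic] allows for [x; y] with x and y
   adjacent, which [ucycle] accepts. *)
Record weighted_rooted_tree (R : realType) := WeightedRootedTree {
  vertex : choiceType;
  edge : set (set vertex);
  weight : set vertex -> R;
  root : vertex;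
  edge_pair : forall e, edge e -> exists x y, x <> y /\ e = [set x; y];
  tree_connected : forall x y,
    exists p : seq vertex, path (adjacent edge) x p /\ last x p = y;
  tree_acyclic : forall c : seq vertex,
    ucycle (adjacent edge) c -> (size c <= 2)%N;
  weight_gt0 : forall e, edge e -> 0 < weight e }.

Section Trees.
Variables (R : realType) (G : weighted_rooted_tree R).
Local Notation V := (vertex G).
Local Notation E := (@edge R G).
Local Notation sigma := (@weight R G).
Local Notation o := (root G).

Definition root_path_to (e : set V) (n : nat) : Prop :=
  exists (q : seq V) (y : V),
    [/\ path (adjacent E) o (rcons q y), uniq (o :: rcons q y),
        size (rcons q y) = n & e = [set last o q; y]].

(* Every edge ends exactly one simple path from o, whose number of edges is
   chosen here; the default 0 is only reached off [edge]. *)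
Definition generation (e : set V) : nat :=
  xget 0%N (root_path_to e).

Definition parent (e e' : set V) : Prop :=
  [/\ E e, E e', e `&` e' !=set0 & generation e' = (generation e).+1].

Definition children (e : set V) : set (set V) := [set e' | parent e e'].

Definition locally_finite : Prop :=
  forall x : V, finite_set [set e | E e /\ e x].

Definition proper_infinite_tree : Prop :=
  [/\ infinite_set [set: V], locally_finite &
      forall e, E e -> children e !=set0].

Definition radially_symmetric_tree : Prop :=
  proper_infinite_tree /\
  (forall e e', E e -> E e' -> generation e = generation e' ->
     (children e #= children e')%card).

Definition radially_symmetric_weight : Prop :=
  forall e e', E e -> E e' -> generation e = generation e' ->
    sigma e = sigma e'.

Definition bounded_uniformly_elliptic : Prop :=
  exists alpha1 alpha2 : R, [/\ 0 < alpha1, alpha1 <= alpha2 &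
    forall e, E e -> alpha1 <= sigma e <= alpha2].

(* gamma i is the (i+1)-st edge of the path. *)
Definition infinite_descending_paths : set (nat -> set V) :=
  [set gamma |
    (exists v : nat -> V, v 0%N = o /\
       forall i, gamma i = [set v i; v i.+1]) /\
    (forall i, parent (gamma i) (gamma i.+1))].

Definition path_length (rho : set V -> R) (gamma : nat -> set V) : \bar R :=
  (\sum_(0 <= i <oo) (rho (gamma i))%:E)%E.

Definition admissible : set (set V -> R) :=
  [set rho | (forall e, E e -> 0 <= rho e) /\
    (forall gamma, infinite_descending_paths gamma ->
       (1 <= path_length rho gamma)%E)].

Definition energy (p : R) (rho : set V -> R) : \bar R :=
  (\esum_(e in E) (sigma e * rho e `^ p)%:E)%E.

Definition energy_oo (rho : set V -> R) : \bar R :=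
  ereal_sup [set (sigma e * rho e)%:E | e in E].

Definition modulus (p : R) : \bar R :=
  ereal_inf [set energy p rho | rho in admissible].

Definition modulus_oo : \bar R :=
  ereal_inf [set energy_oo rho | rho in admissible].

End Trees.

(* Main.v *)
Require Import Defs.
From mathcomp Require Import all_boot all_order all_algebra.
From mathcomp Require Import all_classical all_reals all_analysis.
Import Order.TTheory GRing.Theory Num.Theory.
Import numFieldNormedType.Exports.
Local Open Scope classical_set_scope.
Local Open Scope ring_scope.

(** Local finiteness gives, for every k > 0, a finite edge set F containing the
    first k edges of every descending path. The density equal to 1/k on F and 0
    elsewhere is admissible, its p-energy is at most C k^-p with C independent of
    p, and its oo-energy is at most alpha2 / k. Since C <= 2 ^ p for large p, the
    p-th root of the modulus is eventually at most 2 / k. *)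

Section ModulusBounds.
Context {R : realType} {G : weighted_rooted_tree R}.
Local Notation V := (vertex G).
Local Notation E := (@edge R G).
Local Notation sigma := (@weight R G).

Definition star (A : set V) : set (set V) :=
  \bigcup_(x in A) [set e | E e /\ e x].

(** Each step keeps both endpoints of every edge met, so once an edge exists this is the ball of
    radius [n] around the root, not the sphere. Overshooting is harmless: what matters is finiteness
    and catching the vertex number [n] of every descending path. *)
Definition walk_ends (n : nat) : set V :=
  iter n (fun A => \bigcup_(e in star A) e) [set Defs.root G].

Definition initial_edges (k : nat) : set (set V) :=
  \bigcup_(i in `I_k) star (walk_ends i).

Definition uniform_density (k : nat) (e : set V) : R :=
  if e \in initial_edges k then k%:R^-1 else 0.

Lemma finite_edge e : E e -> finite_set e.
Proof. by move=> /edge_pair[x [y [_ ->]]]; exact: finite_set2. Qed.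

Lemma finite_star A : locally_finite G -> finite_set A -> finite_set (star A).
Proof. by move=> lf fA; apply: bigcup_finite => // x _; exact: lf. Qed.

Lemma finite_walk_ends n : locally_finite G -> finite_set (walk_ends n).
Proof.
move=> lf; elim: n => [|n IHn]; first exact: finite_set1.
apply: bigcup_finite; first exact: finite_star.
by move=> e [x _ [Ee _]]; exact: finite_edge.
Qed.

Lemma finite_initial_edges k : locally_finite G -> finite_set (initial_edges k).
Proof.
move=> lf; apply: bigcup_finite => [|i _]; first exact: finite_II.
by apply: finite_star => //; exact: finite_walk_ends.
Qed.

Lemma initial_edges_sub k : initial_edges k `<=` E.
Proof. by move=> e [i _ [x _ [Ee _]]]. Qed.

Lemma descending_initial_edges k gamma i :
  infinite_descending_paths gamma -> (i < k)%N -> initial_edges k (gamma i).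
Proof.
move=> [[v [v0 gammaE]] par] ik; exists i => //; exists (v i); last first.
  by split; [have [] := par i | rewrite gammaE; left].
(* The induction shows that [v i] lies in [walk_ends i]: the edge [gamma i] leaves [v i] and
   contributes [v i.+1]. *)
elim: i {ik} => [|i IHi]; first exact: v0.
exists (gamma i); last by rewrite gammaE; right.
by exists (v i) => //; split; [have [] := par i | rewrite gammaE; left].
Qed.

Lemma uniform_density_ge0 k e : 0 <= uniform_density k e.
Proof. by rewrite /uniform_density; case: ifP; rewrite ?invr_ge0. Qed.

Lemma admissible_uniform_density k :
  (0 < k)%N -> admissible (uniform_density k).
Proof.
move=> k0; split=> [e _|gamma hgamma]; first exact: uniform_density_ge0.
(* The first [k] edges alone give length [k * k^-1 = 1]; the tail is nonnegative. *)
apply: (@le_trans _ _ (\sum_(0 <= i < k) (uniform_density k (gamma i))%:E)%E).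
  rewrite sumEFin lee_fin big_mkord (eq_bigr (fun=> k%:R^-1)) => [|i _].
    by rewrite sumr_const card_ord -[_ *+ k]mulr_natr mulVf// pnatr_eq0 -lt0n.
  rewrite /uniform_density mem_set//.
  exact: descending_initial_edges (ltn_ord i).
by apply: nneseries_lim_ge => i _ _; rewrite lee_fin uniform_density_ge0.
Qed.

(** [C] is the total weight of the finite set [initial_edges k]; that it is chosen before [p] is
    what allows [p] to grow afterwards. *)
Lemma energy_uniform_density k : locally_finite G ->
  exists C : R, forall p, 0 < p ->
    energy p (uniform_density k) = (C * k%:R^-1 `^ p)%:E.
Proof.
move=> lf; set F := initial_edges k.
have finF : finite_set F by exact: finite_initial_edges.
exists (\sum_(e \in F) sigma e) => p p0.
rewrite /energy (eq_esum (b := fun e =>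
    if e \in F then (sigma e * k%:R^-1 `^ p)%:E else 0%E)); last first.
  move=> e _; rewrite /uniform_density -/F; case: ifP => // _.
  by rewrite powR0 ?gt_eqF// mulr0.
rewrite -esum_mkcondr (setIidr (@initial_edges_sub k)) esum_fset//.
  by rewrite !fsbig_finite//= sumEFin mulr_suml.
move=> e; rewrite inE => /initial_edges_sub Ee.
by rewrite lee_fin mulr_ge0 ?powR_ge0// ltW// weight_gt0.
Qed.

Lemma modulus_ge0 p : (0 <= modulus G p)%E.
Proof.
apply: le_ereal_inf_tmp => _ [rho _ <-]; apply: esum_ge0 => e Ee.
by rewrite lee_fin mulr_ge0 ?powR_ge0// ltW// weight_gt0.
Qed.

Lemma modulus_root_le k : locally_finite G -> (0 < k)%N ->
  \forall p \near +oo%R, (modulus G p `^ p^-1 <= (2 / k%:R)%:E)%E.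
Proof.
move=> lf k0; have [C CE] := energy_uniform_density k lf.
near=> p.
have p0 : 0 < p by near: p; exact: nbhs_pinfty_gt.
(* For [C > 0] this reads [ln C / ln 2 <= p], true near infinity since [C] is fixed. Any base above
   1 could replace 2. *)
have C2p : C <= 2 `^ p.
  have [C0|C0] := leP C 0; first by rewrite (le_trans C0)// powR_ge0.
  have ln2 : 0 < ln (2 : R) by rewrite ln_gt0// ltr1n.
  rewrite -ler_ln ?posrE ?powR_gt0// ln_powR -ler_pdivrMr//.
have modE : (modulus G p <= ((2 / k%:R) `^ p)%:E)%E.
  apply: ge_ereal_inf; exists (energy p (uniform_density k)).
    by exists (uniform_density k) => //; exact: admissible_uniform_density.
  rewrite CE// lee_fin powRM ?invr_ge0//.
  by rewrite ler_wpM2r// powR_ge0.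
have -> : (2 / k%:R)%:E = (((2 / k%:R) `^ p)%:E `^ p^-1)%E :> \bar R.
  by rewrite poweR_EFin -powRrM divff ?gt_eqF// powRr1// divr_ge0.
apply: gt0_ler_poweR => //; first by rewrite invr_ge0 ltW.
- by rewrite in_itv/= modulus_ge0 leey.
- by rewrite in_itv/= lee_fin powR_ge0 leey.
Unshelve. all: by end_near.
Qed.

Lemma exists_invr_lt (a eps : R) :
  0 < eps -> exists2 k : nat, (0 < k)%N & a / k%:R < eps.
Proof.
move=> eps0; exists (Num.truncn (`|a| / eps)).+1 => //.
rewrite ltr_pdivrMr// mulrC -ltr_pdivrMr//.
apply: le_lt_trans (truncnS_gt _).
by rewrite ler_wpM2r ?invr_ge0 ?ler_norm// ltW.
Qed.

Lemma modulus_root_cvg0 : locally_finite G ->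
  (modulus G p `^ p^-1)%E @[p --> +oo%R] --> 0%E.
Proof.
move=> lf; have bound eps : 0 < eps ->
    \forall p \near +oo%R, (modulus G p `^ p^-1 < eps%:E)%E.
  move=> /(exists_invr_lt 2)[k k0 keps].
  apply: filterS (modulus_root_le k lf k0) => p /le_lt_trans; apply.
  by rewrite lte_fin.
have fin eps p : (modulus G p `^ p^-1 < eps%:E)%E ->
    (modulus G p `^ p^-1)%E \is a fin_num.
  move=> lt_eps; rewrite ge0_fin_numE ?poweR_ge0//.
  by rewrite (lt_trans lt_eps)// ltry.
(* Convergence to a finite limit splits into eventual finiteness, obtained from the bound with
   [eps = 1], and convergence of the real parts. *)
apply/fine_cvgP; split.
  by near=> p; apply: (fin 1); near: p; exact: bound.
apply/cvgrPdist_lt => eps eps0; near=> p.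
have lt_eps : (modulus G p `^ p^-1 < eps%:E)%E by near: p; exact: bound.
rewrite /= sub0r normrN ger0_norm ?fine_ge0 ?poweR_ge0//.
by rewrite -lte_fin fineK// (fin eps).
Unshelve. all: by end_near.
Qed.

Lemma edge_exists : infinite_set [set: V] -> exists e, E e.
Proof.
move=> infV; have [x xo] : exists x, x != Defs.root G.
  apply: contrapT => /forallNP allo; apply: infV.
  rewrite (_ : setT = [set Defs.root G]); first exact: finite_set1.
  by apply/seteqP; split=> // x _; apply: contrapT => /eqP /allo.
have [[|y p] [/= + lastp]] := tree_connected (Defs.root G) x.
  by rewrite -lastp eqxx in xo.
by move=> /andP[/asboolP Ey _]; exists [set Defs.root G; y].
Qed.

(** An edge has to exist here: over an empty edge set the supremum defining [energy_oo] would be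
    [-oo]. *)
Lemma modulus_oo_ge0 : infinite_set [set: V] -> (0 <= modulus_oo G)%E.
Proof.
move=> /edge_exists[e Ee]; apply: le_ereal_inf_tmp => _ [rho [rho0 _] <-].
apply: (@le_trans _ _ (sigma e * rho e)%:E).
  by rewrite lee_fin mulr_ge0 ?rho0// ltW// weight_gt0.
by apply: ereal_sup_ubound; exists e.
Qed.

Lemma modulus_oo_le (a : R) k : (0 < k)%N -> (forall e, E e -> sigma e <= a) ->
  0 <= a -> (modulus_oo G <= (a / k%:R)%:E)%E.
Proof.
move=> k0 lea a0; apply: ge_ereal_inf; exists (energy_oo (uniform_density k)).
  by exists (uniform_density k) => //; exact: admissible_uniform_density.
apply: ge_ereal_sup => _ [e Ee <-]; rewrite lee_fin /uniform_density.
(* Edges outside [initial_edges k] contribute 0, which is below the bound because [0 <= a]. *)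
case: ifP => _; last by rewrite mulr0 divr_ge0.
by rewrite ler_wpM2r ?invr_ge0// lea.
Qed.

End ModulusBounds.

Theorem theorem11 (R : realType) (G : weighted_rooted_tree R)
    (hG : radially_symmetric_tree G)
    (hsym : radially_symmetric_weight G)
    (hell : bounded_uniformly_elliptic G) :
  (modulus G p `^ p^-1)%E @[p --> +oo%R] --> 0%E /\ 0%E = modulus_oo G.
Proof.
have [[infV lf _] _] := hG; split; first exact: modulus_root_cvg0.
have [a1 [a2 [a1_gt0 le_a12 sigma_bnd]]] := hell.
apply/eqP; rewrite eq_le modulus_oo_ge0//=.
(* It remains to bound [modulus_oo G] by every [eps > 0], using a [k] with [a2 / k < eps]. *)
apply/lee_addgt0Pr => eps eps0; rewrite add0e.
have [k k0 lt_eps] := exists_invr_lt a2 eps eps0.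
apply: le_trans (modulus_oo_le a2 k k0 _ _) _.
- by move=> e /sigma_bnd/andP[].
- exact: le_trans (ltW a1_gt0) le_a12.
- by rewrite lee_fin ltW.
Qed.
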